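(* Let $d\ge 1$ and $s\ge 1$ be natural numbers, let $L_1,\dots,L_d$ be linearly ordered compact spaces and let $K_1,K_2,\dots,K_{d+s}$ be infinite compact Hausdorff spaces. If there is a continuous surjection $L_1\times\dots\times L_d\to K_1\times K_2\times\dots\times K_{d+s}$, then at least $s+1$ of the factors $K_j$ are metrizable; that is, there is a set $J\subseteq\{1,\dots,d+s\}$ with $|J|\ge s+1$ such that $K_j$ is metrizable for every $j\in J$.
   Context: A linearly ordered compact space is a linearly ordered set which is compact in its order topology. Products carry the product topology. *)

(* Defs.v *)
From HB Require Import structures.
From mathcomp Require Import all_boot all_order all_algebra.
From mathcomp Require Import all_classical all_reals all_analysis.

Set Implicit Arguments.
Unset Strict Implicit.
Unset Printing Implicit Defensive.

Import Order.TTheory GRing.Theory Num.Theory.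

Local Open Scope classical_set_scope.
Local Open Scope ring_scope.

Definition is_metric (R : realType) (T : Type) (dist : T -> T -> R) : Prop :=
  [/\ forall x y, 0 <= dist x y,
      forall x y, dist x y = 0 <-> x = y,
      forall x y, dist x y = dist y x &
      forall x y z, dist x z <= dist x y + dist y z].

(* [metricType] carries its own topology, so metrizability of an already given
   topology is expressed by a distance whose balls form neighbourhood bases of
   that topology. *)
Definition metrizable (R : realType) (T : topologicalType) : Prop :=
  exists2 dist : T -> T -> R, is_metric dist &
    forall x : T,
      nbhs x = filter_from [set e : R | 0 < e]
                           (fun e => [set y | dist x y < e]).

Lemma metricType_metrizable (R : realType) (T : metricType R) :
  metrizable R T.
Proof.
exists mdist.
  split=> [x y|x y|x y|x y z].
  - exact: mdist_ge0.
  - by split=> [|->]; [exact: mdist_positivity | exact: mdistxx].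
  - exact: metric_sym.
  - exact: metric_triangle.
move=> x; rewrite -nbhs_ballE /nbhs_ball_.
congr filter_from; apply/funext => e; exact: ballEmdist.
Qed.

(* Main.v *)
Require Import Defs.
From HB Require Import structures.
From mathcomp Require Import all_boot all_order all_algebra.
From mathcomp Require Import all_classical all_reals all_analysis.
From mathcomp Require Import lra zify.

Set Implicit Arguments.
Unset Strict Implicit.
Unset Printing Implicit Defensive.

Import Order.TTheory GRing.Theory Num.Theory.
Import numFieldNormedType.Exports.

Local Open Scope classical_set_scope.
Local Open Scope ring_scope.

(** Call grid a choice of finitely many endpoints in every [L i]. With at most N
    endpoints in each coordinate, a grid cuts the product P of the d linear
    orders into at most (2N+1)^d cells, the cells recording how each coordinate
    compares with each endpoint ([cell_code_inj]). By compactness every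
    continuous real function on P varies by less than 1/2 on each cell of some
    grid ([exists_resolving_grid]); say that it has complexity at most k if a
    grid with at most k endpoints per coordinate does this. The number of cells
    is of degree only d in N, and this is what a product of d linear orders
    cannot reconcile with d nonmetrizable factors and one more infinite factor.

    Let [phi] be a continuous map from P to a compact Hausdorff space K. Suppose
    that K is not metrizable. For each k take the functions from K to [0, 1]
    whose composite with [phi] has complexity at most k. Every continuous
    function to [0, 1] is of this kind for some k. If for each k finitely many
    of these functions already told apart all pairs of points on which a function
    of complexity k takes the values 0 and 1, then countably many functions
    would separate the points of K, and K would be metrizable
    ([metrizable_of_separating]). So one single k allows functions to be added
    without end, each separating two points that all previous functions
    identify. Choosing one point from each pair yields, for every n, n functions
    of complexity k and n points of K whose preimages lie in different cells of
    the common grid, which has at most kn endpoints per coordinate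
    ([nonmetrizable_cell_separated]). If K is merely infinite, there are still
    any number M of points separated by some grid, with no control on its number
    c of endpoints ([infinite_cell_separated]).

    Now suppose that at most s of the d + s factors are metrizable. Then d of
    them are not, with constants k_j whose sum is kappa, and since s > 0 there
    is one further factor, which is infinite. Taking n points in each of the d
    nonmetrizable factors and M in the extra one, surjectivity gives M n^d points
    of P in different cells of a grid with c + kappa n endpoints per coordinate,
    hence M n^d <= (2 (c + kappa n) + 1)^d ([cell_separated_count]). As c does
    not depend on n, the choice n = 2c + 1 bounds the right-hand side by
    (2 kappa + 1)^d n^d, which is absurd once M > (2 kappa + 1)^d. *)

(** * Metrizability from countably many separating functions *)

Section SupMetric.
Context {R : realType} {K : topologicalType}.
Variable g : nat -> K -> R.
Hypothesis g01 : forall n x, 0 <= g n x <= 1.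
Hypothesis gcont : forall n, continuous (g n).
Hypothesis gsep : forall x y, (forall n, g n x = g n y) -> x = y.

Let gap (x y : K) (n : nat) : R := `|g n x - g n y| / n.+1%:R.

Let sup_dist (x y : K) : R := sup (range (gap x y)).

Lemma gap_le1 x y n : `|g n x - g n y| <= 1.
Proof.
have /andP[? ?] := g01 n x; have /andP[? ?] := g01 n y.
by rewrite ler_norml; lra.
Qed.

Lemma gap_le_inv x y n : gap x y n <= n.+1%:R^-1.
Proof. by rewrite /gap ler_pdivrMr// mulVf// gap_le1. Qed.

Lemma gap_le_norm x y n : gap x y n <= `|g n x - g n y|.
Proof. by rewrite /gap ler_pdivrMr// ler_peMr// ler1n. Qed.

Lemma gap_le_dist x y n : gap x y n <= sup_dist x y.
Proof.
apply: ub_le_sup; last by exists n.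
exists 1 => _ [m _ <-]; apply: le_trans (gap_le_norm _ _ _) (gap_le1 _ _ _).
Qed.

Lemma dist_le_gap x y (e : R) : (forall n, gap x y n <= e) -> sup_dist x y <= e.
Proof.
by move=> gape; apply: ge_sup => [|_ [n _ <-]//]; exists (gap x y 0); exists 0.
Qed.

Lemma sup_dist_metric : is_metric sup_dist.
Proof.
have gap0 x y n : 0 <= gap x y n by rewrite divr_ge0.
split=> [x y|x y|x y|x y z].
- exact: le_trans (gap0 x y 0) (gap_le_dist _ _ _).
- split=> [xy0|->].
    apply: gsep => n; apply/eqP; rewrite -subr_eq0 -normr_eq0.
    have : gap x y n == 0 by rewrite eq_le gap0 -xy0 gap_le_dist.
    by rewrite /gap mulf_eq0 invr_eq0 pnatr_eq0 orbF.
  apply/eqP; rewrite eq_le (le_trans (gap0 y y 0) (gap_le_dist _ _ _)) andbT.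
  by apply: dist_le_gap => n; rewrite /gap subrr normr0 mul0r.
- rewrite /sup_dist; suff -> : gap x y = gap y x by [].
  by apply/funext => n; rewrite /gap distrC.
- apply: dist_le_gap => n.
  apply: (le_trans _ (lerD (gap_le_dist x y n) (gap_le_dist y z n))).
  by rewrite /gap -mulrDl ler_pM2r ?invr_gt0// ler_distD.
Qed.

(** Only the finitely many [g n] with weight 1/(n+1) at least e/2 constrain [y];
    the gaps of all the others are small because [g n] ranges in [0, 1]. *)
Lemma nbhs_sup_ball x (e : R) : 0 < e -> nbhs x [set y | sup_dist x y < e].
Proof.
move=> e0; have e20 : 0 < e / 2 by rewrite divr_gt0.
have [N _ /(_ N (leqnn N)) Ne] := near_infty_natSinv_lt (PosNum e20).
have near_g : \forall y \near x, forall n : 'I_N, `|g n x - g n y| < e / 2.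
  apply: filter_forall => n.
  exact: (@cvgr_dist_lt _ _ _ _ _ (g n) (g n x) (@gcont n x) _ e20).
apply: filterS near_g => y gy /=.
apply: (@le_lt_trans _ _ (e / 2)); last by rewrite ltr_pdivrMr//; lra.
apply: dist_le_gap => n; have [nN|Nn] := ltnP n N.
  exact: le_trans (gap_le_norm _ _ _) (ltW (gy (Ordinal nN))).
apply: le_trans (gap_le_inv _ _ _) (le_trans _ (ltW Ne)).
by rewrite lef_pV2 ?posrE// ler_nat ltnS.
Qed.

(** If no ball around [x] were contained in the neighbourhood [U], the parts of
    the balls outside [U] would accumulate at some [p] by compactness; then [p]
    is at distance 0 from [x], hence equal to [x], although [U] is a
    neighbourhood of [x] that misses all these parts. *)
Lemma metrizable_of_separating : compact [set: K] -> metrizable R K.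
Proof.
move=> Kcpt; have [dge0 deq dsym dtri] := sup_dist_metric.
exists sup_dist; first exact: sup_dist_metric.
move=> x; apply/seteqP; split=> [U xU|U [e e0 eU]]; last first.
  by apply: filterS eU _; exact: nbhs_sup_ball.
apply: contrapT => noball.
pose F := filter_from [set e : R | 0 < e]
  (fun e => [set y | sup_dist x y < e] `\` U).
have FF : ProperFilter F.
  apply: filter_from_proper.
    apply: filter_from_filter; first by exists 1 => /=.
    move=> a b a0 b0; exists (Num.min a b) => /=; first by rewrite lt_min a0 b0.
    by move=> y [/= + ?]; rewrite lt_min => /andP[].
  move=> e e0; apply/set0P/negP => /eqP/disjoints_subset eU; apply: noball.
  by exists e => // y ye; have := eU y ye; rewrite setCK.
have [p [_ clp]] := Kcpt F FF filterT.
have Fball e : 0 < e -> F ([set y | sup_dist x y < e] `\` U).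
  by move=> e0; exists e.
have xp : x = p.
  apply/deq/eqP; rewrite eq_le dge0 andbT; apply/ler_addgt0Pr => e e0.
  have e20 : 0 < e / 2 by rewrite divr_gt0.
  have [q [[/= xq _] pq]] := clp _ _ (Fball _ e20) (nbhs_sup_ball p e20).
  have := dtri x q p; rewrite (dsym q p); move: pq => /=; lra.
rewrite -xp in clp.
by have [q [[_ nUq] /nUq]] := clp _ U (Fball 1 ltr01) xU.
Qed.

End SupMetric.

(** * Grids in a product of linear orders *)

Section Grids.
Context {disp : Order.disp_t} {d : nat} {L : 'I_d -> orderTopologicalType disp}.

Definition grid := forall i, seq (L i).

(** The cells are products whose sides are single endpoints or the open intervals
    and rays that the endpoints leave. *)
Definition same_cell (F : grid) (u v : forall i, L i) : Prop :=
  forall i c, c \in F i ->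
    (c < u i)%O = (c < v i)%O /\ (c <= u i)%O = (c <= v i)%O.

Definition grid_cat (F G : grid) : grid := fun i => F i ++ G i.

Lemma same_cell_sub (F G : grid) u v :
  (forall i, {subset F i <= G i}) -> same_cell G u v -> same_cell F u v.
Proof. by move=> FG cell i c /FG; exact: cell. Qed.

Lemma same_cell_sym F u v : same_cell F u v -> same_cell F v u.
Proof. by move=> cell i c /cell[-> ->]. Qed.

Lemma same_cell_catl F G u v : same_cell (grid_cat F G) u v -> same_cell F u v.
Proof. by apply: same_cell_sub => i c cF; rewrite mem_cat cF. Qed.

Lemma same_cell_catr F G u v : same_cell (grid_cat F G) u v -> same_cell G u v.
Proof. by apply: same_cell_sub => i c cG; rewrite mem_cat cG orbT. Qed.

Definition bound_points {i} (b : itv_bound (L i)) : seq (L i) :=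
  if b is BSide _ c then [:: c] else [::].

Definition slab_grid i (I : interval (L i)) : grid :=
  let: Interval b b' := I in
  dfwith (fun j => [::]) i (bound_points b ++ bound_points b').

Lemma same_cell_slab i (I : interval (L i)) u v :
  same_cell (slab_grid I) u v -> (u i \in I) = (v i \in I).
Proof.
case: I => b b' /(_ i); rewrite /= dfwithin => cell.
have cellP c : c \in bound_points b ++ bound_points b' ->
    [/\ (c < u i)%O = (c < v i)%O, (c <= u i)%O = (c <= v i)%O,
        (u i < c)%O = (v i < c)%O & (u i <= c)%O = (v i <= c)%O].
  by move=> /cell[lt le]; split=> //; [rewrite !ltNge le|rewrite !leNgt lt].
rewrite !itv_boundlr; congr (_ && _).
  case: b cellP {cell} => [[] c|[]] //= /(_ c);
  by rewrite !inE eqxx => /(_ isT)[lt le _ _]; rewrite ?bnd_simp.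
case: b' cellP {cell} => [[] c|[]] //= /(_ c);
by rewrite mem_cat !inE eqxx orbT => /(_ isT)[_ _ lt le]; rewrite ?bnd_simp.
Qed.

Local Notation P := (prod_topology (fun i => L i)).

(** Small boxes with sides open intervals are unions of cells of the grid formed
    by their own finitely many endpoints. *)
Lemma saturated_nbhs (p : P) (U : set P) : nbhs p U ->
  exists F : grid, exists B : set P, [/\ nbhs p B, B `<=` U &
    forall u v, B u -> same_cell F u v -> B v].
Proof.
pose S : set_system P := [set U | exists F : grid, exists B : set P,
  [/\ nbhs p B, B `<=` U & forall u v, B u -> same_cell F u v -> B v]].
have FS : Filter S.
  split.
  - by exists (fun=> [::]), setT; split=> //; exact: filterT.
  - move=> V W [F [B [pB BV satB]]] [G [C [pC CW satC]]].
    exists (grid_cat F G), (B `&` C); split; first exact: filterI.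
      by move=> x [/BV ? /CW].
    move=> u v [Bu Cu] cell; split.
      exact: satB Bu (same_cell_catl cell).
    exact: satC Cu (same_cell_catr cell).
  - move=> V W VW [F [B [pB BV satB]]]; exists F, B; split=> //.
    exact: subset_trans VW.
(* The product topology is generated by the projections, so it is enough to
   treat one coordinate at a time. *)
suff /(_ U) : S --> p by [].
apply/cvg_sup => i A [_ [[W oW <-] Wpi /filterS]]; apply.
have : nbhs (p i) W by exact: open_nbhs_nbhs.
rewrite itv_nbhsE => -[I [Iopen pI] IW].
exists (slab_grid I), [set u | u i \in I]; split.
- apply: (@proj_continuous _ (fun i => L i) i p [set` I]).
  by rewrite itv_nbhsE; exists I.
- by move=> u /= uI; exact: IW.
- by move=> u v /= uI /same_cell_slab <-.
Qed.

Context {R : realType}.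

Definition resolves (F : grid) (h : P -> R) : Prop :=
  forall u v, same_cell F u v -> `|h u - h v| < 1 / 2.

(** A small box around a point is a union of cells of a grid, and [h] varies
    little on it; compactness joins finitely many of these grids into one. *)
Lemma exists_resolving_grid (h : P -> R) :
  (forall i, compact [set: L i]) -> continuous h -> exists F, resolves F h.
Proof.
move=> Lcpt hcont.
have Pcpt : compact [set: P].
  have := @tychonoff _ (fun i => L i : topologicalType) (fun=> setT) Lcpt.
  by congr compact; apply/seteqP; split.
pose good (D : set P) := exists F,
  forall u v, D u -> same_cell F u v -> `|h u - h v| < 1 / 2.
suff [F goodF] : good setT by exists F => u v; exact: goodF.
apply: contrapT => bad.
(* Good sets form an ideal, because grids can be joined; if it were proper, the
   dual filter would have a cluster point, yet every point has a good
   neighbourhood. *)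
pose S : set_system P := [set D | good (~` D)].
have FS : ProperFilter S.
  split; first by rewrite /S /= setC0.
  split.
  - by exists (fun=> [::]) => u v; rewrite setCT.
  - move=> V W [F goodF] [G goodG]; exists (grid_cat F G) => u v.
    rewrite setCI => -[Vu|Wu] cell.
      exact: goodF Vu (same_cell_catl cell).
    exact: goodG Wu (same_cell_catr cell).
  - move=> V W VW [F goodF]; exists F => u v Wu; apply: goodF.
    by move=> /VW.
have [p [_ clp]] := Pcpt S FS filterT.
(* Two values within 1/4 of [h p] are within 1/2 of each other. *)
have pU : nbhs p [set u | `|h p - h u| < 1 / 4].
  by apply: (@cvgr_dist_lt _ _ _ _ _ h (h p) (hcont p)); lra.
have [F [B [pB BU satB]]] := saturated_nbhs pU.
have SB : S (~` B).
  exists F => u v; rewrite setCK => Bu cell.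
  have /= := BU _ Bu; have /= := BU _ (satB _ _ Bu cell).
  by rewrite !ltr_norml; lra.
by have [x []] := clp _ _ SB pB.
Qed.

Definition complexity_le (k : nat) (h : P -> R) : Prop :=
  exists2 F : grid, (forall i, size (F i) <= k)%N & resolves F h.

Lemma exists_complexity (h : P -> R) :
  (forall i, compact [set: L i]) -> continuous h -> exists k, complexity_le k h.
Proof.
move=> Lcpt /(exists_resolving_grid Lcpt)[F hF].
by exists (\max_i size (F i))%N, F => // i; exact: leq_bigmax.
Qed.

End Grids.

(** * Counting cells *)

Lemma eq_count_sub {T : eqType} (a b : pred T) (s : seq T) :
  subpred a b -> count a s = count b s -> {in s, a =1 b}.
Proof.
move=> ab; elim: s => //= x s IHs.
have := sub_count ab s; have := ab x.
case ax: (a x); case bx: (b x) => /= abx le_ab.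
- move/eqP; rewrite eqn_add2l => /eqP/IHs eqab y.
  by rewrite inE => /orP[/eqP->|/eqab//]; rewrite ax bx.
- by have := abx isT.
- by rewrite add0n add1n => e; rewrite e ltnn in le_ab.
- move/eqP; rewrite eqn_add2l => /eqP/IHs eqab y.
  by rewrite inE => /orP[/eqP->|/eqab//]; rewrite ax bx.
Qed.

Section CountingCells.
Context {disp : Order.disp_t} {d : nat} {L : 'I_d -> orderTopologicalType disp}.

(** In the order of [L i], each endpoint increases this number once when [x]
    reaches it and once more when [x] passes it. *)
Definition interval_rank {i} (s : seq (L i)) (x : L i) : nat :=
  (count (fun c => (c < x)%O) s + count (fun c => (c <= x)%O) s)%N.

Lemma interval_rank_le {i} (s : seq (L i)) x :
  (interval_rank s x <= (size s).*2)%N.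
Proof. by rewrite -addnn leq_add// count_size. Qed.

(** Both counts increase with [x], so equality of their sums forces equality of
    each, and the sets of endpoints below [x] and [y] agree. *)
Lemma interval_rank_inj {i} (s : seq (L i)) x y c :
  interval_rank s x = interval_rank s y -> c \in s ->
  (c < x)%O = (c < y)%O /\ (c <= x)%O = (c <= y)%O.
Proof.
wlog xy : x y / (x <= y)%O.
  move=> wl exy cs; have [/wl|/ltW /wl] := leP x y; first exact.
  by move=> /(_ (esym exy) cs)[-> ->].
move=> exy cs.
have sub1 : subpred (fun c => c < x)%O (fun c => c < y)%O.
  by move=> z zx; exact: lt_le_trans xy.
have sub2 : subpred (fun c => c <= x)%O (fun c => c <= y)%O.
  by move=> z zx; exact: le_trans xy.
have [eq1 eq2] : count (fun c => c < x)%O s = count (fun c => c < y)%O s /\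
    count (fun c => c <= x)%O s = count (fun c => c <= y)%O s.
  have := sub_count sub1 s; have := sub_count sub2 s; move: exy.
  rewrite /interval_rank.
  by move: (count _ s) (count _ s) (count _ s) (count _ s) => k l m n; lia.
by split; [exact: (eq_count_sub sub1 eq1 cs)|exact: (eq_count_sub sub2 eq2 cs)].
Qed.

Definition cell_code (N : nat) (F : @grid disp d L) (u : forall i, L i) :
    {ffun 'I_d -> 'I_(N.*2.+1)} :=
  [ffun i => inord (interval_rank (F i) (u i))].

Lemma cell_code_inj N (F : @grid disp d L) u v :
  (forall i, size (F i) <= N)%N ->
  cell_code N F u = cell_code N F v -> same_cell F u v.
Proof.
move=> FN /ffunP euv i c ci; apply: (interval_rank_inj _ ci).
have rankN x : (interval_rank (F i) x < N.*2.+1)%N.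
  by rewrite ltnS (leq_trans (interval_rank_le _ _))// leq_double.
have := congr1 val (euv i); rewrite !ffunE /= !inordK//.
Qed.

End CountingCells.

(** * Families of points separated by the cells of a grid *)

Section SeparatedFamilies.
Context {disp : Order.disp_t} {d : nat} {L : 'I_d -> orderTopologicalType disp}.
Local Notation P := (prod_topology (fun i => L i)).

Definition cell_separated {K : Type} (phi : P -> K) (m N : nat) : Prop :=
  exists z : 'I_m -> K, exists2 F : @grid disp d L,
    (forall i, size (F i) <= N)%N &
    forall u v a b, same_cell F u v -> phi u = z a -> phi v = z b -> a = b.

(** There are as many ways to choose one of the [m j] points in each factor as
    the left-hand side says. Each choice is a point of the product, and preimages
    of two such points lie in different cells of the grid that joins all the
    given ones. *)
Lemma cell_separated_count {J : finType} {K : J -> Type}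
    (f : P -> forall j, K j) (m N : J -> nat) :
  (forall y, exists x, f x = y) ->
  (forall j, cell_separated (fun u => f u j) (m j) (N j)) ->
  (\prod_j m j <= (\sum_j N j).*2.+1 ^ d)%N.
Proof.
move=> fsurj sep.
have [z /fin_all_exists2[F FN Fsep]] := fin_all_exists sep.
pose A := {dffun forall j : J, 'I_(m j)}.
have [p pE] := choice (fun a : A => fsurj (fun j => z j (a j))).
pose G : @grid disp d L := fun i => flatten [seq F j i | j <- enum J].
have GN i : (size (G i) <= \sum_j N j)%N.
  rewrite size_flatten /shape -map_comp sumnE big_map -big_enum /=.
  by apply: leq_sum => j _; exact: FN.
have code_inj : injective (fun a : A => cell_code (\sum_j N j)%N G (p a)).
  move=> a b /(cell_code_inj GN) cell; apply/ffunP => j.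
  apply: Fsep (_ : f (p a) j = _) (_ : f (p b) j = _).
  - apply: same_cell_sub cell => i c cF; apply/flattenP; exists (F j i) => //.
    by apply/mapP; exists j; rewrite ?mem_enum.
  - by rewrite pE.
  - by rewrite pE.
have := leq_card _ code_inj.
rewrite card_ffun !card_ord.
rewrite card_dep_ffun foldrE big_map big_enum /=.
by under eq_bigr do rewrite card_ord.
Qed.

Lemma cell_separated1 {K : Type} (phi : P -> K) (x : K) :
  cell_separated phi 1 0.
Proof.
by exists (fun=> x), (fun=> [::]) => // u v a b _ _ _; rewrite !ord1.
Qed.

Context {R : realType}.

Lemma common_grid {T : eqType} (k : nat) (s : seq T) (h : T -> P -> R) :
  (forall t, t \in s -> complexity_le k (h t)) ->
  exists2 F : @grid disp d L, (forall i, size (F i) <= k * size s)%N &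
    forall t, t \in s -> resolves F (h t).
Proof.
elim: s => [_|t s IHs hs]; first by exists (fun=> [::]).
have [t' t's|F Fk Fh] := IHs; first by apply: hs; rewrite inE t's orbT.
have [G Gk Gh] := hs t (mem_head _ _).
exists (grid_cat G F) => [i|t'].
  by rewrite size_cat /= mulnS leq_add.
rewrite inE => /orP[/eqP->|/Fh Ft'] u v cell.
  exact: Gh (same_cell_catl cell).
exact: Ft' (same_cell_catr cell).
Qed.

Context {K : topologicalType}.
Hypothesis Lcpt : forall i, compact [set: L i].
Hypothesis Kcpt : compact [set: K].
Hypothesis KT2 : hausdorff_space K.
Variable phi : P -> K.
Hypothesis phi_cont : continuous phi.

Lemma separating_function (x y : K) : x <> y ->
  exists g : K -> R,
    [/\ continuous g, forall t, 0 <= g t <= 1, g x = 0 & g y = 1].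
Proof.
move=> xy; have Knormal := compact_normal KT2 Kcpt.
have closed1 := accessible_closed_set1 (hausdorff_accessible KT2).
have /(normal_separatorP (R := R))/(_ [set x] [set y]) := Knormal.
case/(_ (closed1 x) (closed1 y))/(_ _)/(uniform_separatorP (R := R)).
  by rewrite -subset0 => t /= [-> /xy].
move=> g [gc g01 gx gy].
exists g; split=> //.
- by move=> t; have /= := g01 (g t) (ex_intro2 _ _ t I erefl); rewrite in_itv.
- by apply: gx; exists x.
- by apply: gy; exists y.
Qed.

(** Finitely many Urysohn functions separate [m] chosen points pairwise. Their
    complexities are arbitrary, so [N] depends on [m] in an uncontrolled way. *)
Lemma infinite_cell_separated (m : nat) : infinite_set [set: K] ->
  exists N, cell_separated phi m N.
Proof.
move=> /infiniteP/card_leP[/= e].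
pose z (a : 'I_m) : K := val (e (SigSub (mem_setT (nat_of_ord a)))).
have zinj : injective z.
  move=> a b /val_inj eab; apply/val_inj.
  have := 'inj_e (in_setT _) (in_setT _) eab.
  by move/(congr1 val).
have sep_ab (ab : 'I_m * 'I_m) : exists h : K -> R, ab.1 != ab.2 ->
    continuous h /\ `|h (z ab.1) - h (z ab.2)| = 1.
  have [ab_eq|ab_neq] := eqVneq ab.1 ab.2; first by exists (fun=> 0).
  have /separating_function[h [hc _ ha hb]] : z ab.1 <> z ab.2.
    by move/zinj/eqP; rewrite (negPf ab_neq).
  by exists h => _; split=> //; rewrite ha hb sub0r normrN normr1.
have [g gP] := choice sep_ab.
pose s := [seq ab <- enum {: 'I_m * 'I_m} | ab.1 != ab.2].
have cplx (ab : 'I_m * 'I_m) : exists k,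
    ab \in s -> complexity_le k (g ab \o phi).
  have [|_] := boolP (ab \in s); last by exists 0%N.
  rewrite mem_filter => /andP[/gP[gc _] _].
  have [k] : exists k, complexity_le k (g ab \o phi).
    apply: exists_complexity => // u.
    by apply: continuous_comp; [exact: phi_cont|exact: gc].
  by exists k.
have [c cP] := choice cplx.
have [F FN Fg] : exists2 F : @grid disp d L,
    (forall i, size (F i) <= (\max_ab c ab) * size s)%N &
    forall ab, ab \in s -> resolves F (g ab \o phi).
  apply: common_grid => ab /cP[F Fc Fg]; exists F => // i.
  exact: leq_trans (Fc i) (leq_bigmax ab).
exists ((\max_ab c ab) * size s)%N, z, F => // u v a b cell ua vb.
apply/eqP; apply: contrapT => /negP ab.
have abs : (a, b) \in s by rewrite mem_filter ab mem_enum.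
have := Fg _ abs u v cell; rewrite /= ua vb (gP (a, b) ab).2; lra.
Qed.

Definition tame_fun (k : nat) (g : K -> R) : Prop :=
  [/\ continuous g, forall t, 0 <= g t <= 1 & complexity_le k (g \o phi)].

(** Otherwise some finite set [Q k] of functions would distinguish, for every k,
    any two points at which a function of complexity k takes the values 0 and 1.
    As every Urysohn function has some complexity, the union of the countably many finite sets
    [Q k] would separate points and make [K] metrizable. Here a triple
    [(h, (x, y))] stands for a function with values 0 at [x] and 1 at [y]. *)
Lemma nonmetrizable_fresh_pair : ~ metrizable R K ->
  exists k, forall Q : seq (K -> R), (forall h, h \in Q -> tame_fun k h) ->
    exists t : (K -> R) * (K * K), [/\ tame_fun k t.1, t.1 t.2.1 = 0,
      t.1 t.2.2 = 1 & forall h, h \in Q -> h t.2.1 = h t.2.2].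
Proof.
move=> nmet; apply: contrapT => noK; apply: nmet.
have {noK} finite_test k : exists Q : seq (K -> R),
    (forall h, h \in Q -> tame_fun k h) /\
    forall g x y, tame_fun k g -> (forall h, h \in Q -> h x = h y) ->
      g x = 0 -> g y = 1 -> False.
  apply: contrapT => noQ; apply: noK; exists k => Q Qk.
  apply: contrapT => noT; apply: noQ; exists Q; split=> // g x y gk Qxy gx gy.
  by apply: noT; exists (g, (x, y)).
have [Q QP] := choice finite_test.
pose g (n : nat) : K -> R :=
  oapp (fun ki : nat * nat => nth (fun=> 0) (Q ki.1) ki.2) (fun=> 0)
    (unpickle n).
have gP n : continuous (g n) /\ forall t, 0 <= g n t <= 1.
  have zero01 : 0 <= (0 : R) <= 1 by rewrite lexx ler01.
  rewrite /g; case: (unpickle n) => [[k i]|] /=; last first.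
    by split=> // ?; exact: cvg_cst.
  have [iQ|Qi] := ltnP i (size (Q k)); last first.
    by rewrite nth_default//; split=> // ?; exact: cvg_cst.
  by have [/(_ _ (mem_nth (fun=> 0) iQ))[]] := QP k.
apply: (metrizable_of_separating (g := g)) => //.
- by move=> n; have [] := gP n.
- by move=> n; have [] := gP n.
move=> x y gxy; apply: contrapT => /separating_function[h [hc h01 hx hy]].
have [k hk] : exists k, complexity_le k (h \o phi).
  apply: exists_complexity => // u.
  by apply: continuous_comp; [exact: phi_cont|exact: hc].
apply: (QP k).2 (_ : tame_fun k h) _ hx hy => // h' h'Q.
have := gxy (pickle (k, index h' (Q k))).
by rewrite /g pickleK /= nth_index.
Qed.

(** Iterating [nonmetrizable_fresh_pair]: every function of the chain identifies
    the two points of each later triple. *)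
Lemma nonmetrizable_chain : ~ metrizable R K ->
  exists k, forall n, exists l : seq ((K -> R) * (K * K)), [/\ size l = n,
    forall t, t \in l -> [/\ tame_fun k t.1, t.1 t.2.1 = 0 & t.1 t.2.2 = 1] &
    pairwise (fun s t => s.1 t.2.1 == s.1 t.2.2) l].
Proof.
move=> /nonmetrizable_fresh_pair[k fresh]; exists k => n.
(* The induction is on the length, with the functions already in use kept as a
   parameter: the chain grows at its head. *)
suff [l [ln lk lpair _]] : exists l : seq ((K -> R) * (K * K)), [/\ size l = n,
    forall t, t \in l -> [/\ tame_fun k t.1, t.1 t.2.1 = 0 & t.1 t.2.2 = 1],
    pairwise (fun s t => s.1 t.2.1 == s.1 t.2.2) l &
    forall h t, h \in ([::] : seq (K -> R)) -> t \in l -> h t.2.1 = h t.2.2].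
  by exists l.
have : forall h, h \in ([::] : seq (K -> R)) -> tame_fun k h by [].
elim: n [::] => [|n IHn] Q Qk; first by exists [::].
have [t [tk tx ty Qt]] := fresh Q Qk.
have [h|l [ln lk lpair lQ]] := IHn (t.1 :: Q).
  by rewrite inE => /orP[/eqP->//|/Qk].
exists (t :: l); split.
- by rewrite /= ln.
- by move=> t'; rewrite inE => /orP[/eqP->|/lk].
- rewrite /= lpair andbT; apply/allP => t' t'l.
  by apply/eqP; apply: lQ => //; exact: mem_head.
- move=> h t' hQ; rewrite inE => /orP[/eqP->|]; first exact: Qt.
  by apply: lQ; rewrite inE hQ orbT.
Qed.

(** The first function takes one value c_t on both points of each later triple
    t. For at least half of these triples, c_t <= 1/2, or for at least half,
    c_t > 1/2; the point where the first function equals 1, respectively 0, is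
    then at least 1/2 away from all of them in the value of that function. Keep that point and that half, and repeat.
    Only the function of the earlier point is used to separate two points, so
    that n points need only n functions. *)
Lemma half_separated_subchain (k n : nat) (l : seq ((K -> R) * (K * K))) :
  (2 ^ n <= (size l).+1)%N ->
  (forall t, t \in l -> [/\ tame_fun k t.1, t.1 t.2.1 = 0 & t.1 t.2.2 = 1]) ->
  pairwise (fun s t => s.1 t.2.1 == s.1 t.2.2) l ->
  exists r : seq ((K -> R) * K), [/\ size r = n,
    forall p, p \in r -> exists2 t, t \in l & p.1 = t.1 /\
      (p.2 = t.2.1 \/ p.2 = t.2.2) &
    pairwise (fun p q => 1 / 2 <= `|p.1 p.2 - p.1 q.2|) r].
Proof.
elim: n l => [|n IHn] [|t l] //= ln lk; first by exists [::].
  by exists [::].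
  by move: ln; rewrite expnS; have := expn_gt0 2 n; lia.
move=> /andP[/allP tl lpair].
have [gk tx ty] := lk t (mem_head _ _).
pose low (s : (K -> R) * (K * K)) := t.1 s.2.1 <= 1 / 2.
have [a [w [tw alow asize]]] : exists a : pred ((K -> R) * (K * K)),
  exists w : K,
    [/\ w = t.2.1 \/ w = t.2.2,
        forall s, a s -> 1 / 2 <= `|t.1 w - t.1 s.2.1| &
        (2 ^ n <= (count a l).+1)%N].
  have : (2 ^ n <= (count low l).+1)%N \/ (2 ^ n <= (count (predC low) l).+1)%N.
    by have := count_predC low l; move: ln; rewrite expnS; lia.
  case=> size_half.
    exists low, t.2.2; split=> //; first by right.
    by move=> s; rewrite /low ty => st; rewrite ler_normr; apply/orP; left; lra.
  exists (predC low), t.2.1; split=> //; first by left.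
  move=> s; rewrite /= /low tx -ltNge => st.
  by rewrite ler_normr; apply/orP; right; lra.
have [|||r [rn rl rpair]] := IHn [seq s <- l | a s].
- by rewrite size_filter.
- move=> s; rewrite mem_filter => /andP[_ sl].
  by apply: lk; rewrite inE sl orbT.
- exact: pairwise_filter.
exists ((t.1, w) :: r); split.
- by rewrite /= rn.
- move=> p; rewrite inE => /orP[/eqP->|/rl[s]].
    by exists t; rewrite ?mem_head.
  by rewrite mem_filter => /andP[_ sl]; exists s => //; rewrite inE sl orbT.
- rewrite /= rpair andbT; apply/allP => q /rl[s]; rewrite mem_filter.
  move=> /andP[/alow sw /tl/eqP ts] [_ []] -> //=.
  by rewrite -ts.
Qed.

(** The chain of length 2^n, with [k] fixed once and for all, leaves n points
    after the choice of one point per pair, and their n functions share a grid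
    of size linear in n; the counting argument needs a slope independent of n. *)
Lemma nonmetrizable_cell_separated : ~ metrizable R K ->
  exists k, forall n, cell_separated phi n (k * n).
Proof.
move=> /nonmetrizable_chain[k chain]; exists k => n.
have [l [ln lk lpair]] := chain (2 ^ n)%N.
have half := @half_separated_subchain k n l _ lk lpair.
have [|r [rn rl rpair]] := half; first by rewrite ln.
have [|F FN Fr] := @common_grid _ k r (fun p => p.1 \o phi).
  by move=> p /rl[t /lk[[_ _ tk] _ _] [-> _]].
have rsize : size r == n by rewrite rn.
pose p (a : 'I_n) := tnth (Tuple rsize) a.
have pr a : p a \in r by exact: mem_tnth.
have p_apart (a b : 'I_n) : (a < b)%N ->
    1 / 2 <= `|(p a).1 (p a).2 - (p a).1 (p b).2|.
  move=> ab; rewrite /p !(tnth_nth (p a)) /=.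
  by have /(pairwiseP (p a)) := rpair; apply=> //; rewrite inE rn.
have apart (a b : 'I_n) u v : (a < b)%N -> same_cell F u v ->
    phi u = (p a).2 -> phi v = (p b).2 -> False.
  move=> ab cell ua vb; have := Fr _ (pr a) u v cell; have := p_apart _ _ ab.
  by rewrite /= ua vb; lra.
exists (fun a => (p a).2), F => [i|u v a b cell ua vb]; first by rewrite -rn.
have [ab|ba|/val_inj//] := ltngtP a b.
  by have := apart _ _ _ _ ab cell ua vb.
by have := apart _ _ _ _ ba (same_cell_sym cell) vb ua.
Qed.

End SeparatedFamilies.

(** * Too many points for too few cells *)

Theorem corollary3p3 (R : realType) (d s : nat) (hd : (1 <= d)%N) (hs : (1 <= s)%N)
    (disp : Order.disp_t)
    (L : 'I_d -> orderTopologicalType disp)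
    (hL : forall i : 'I_d, compact [set: L i])
    (K : 'I_(d + s) -> topologicalType)
    (hKinf : forall j : 'I_(d + s), infinite_set [set: K j])
    (hKcpt : forall j : 'I_(d + s), compact [set: K j])
    (hKT2 : forall j : 'I_(d + s), hausdorff_space (K j))
    (f : prod_topology (fun i : 'I_d => L i) ->
         prod_topology (fun j : 'I_(d + s) => K j))
    (fcont : continuous f)
    (fsurj : forall y, exists x, f x = y) :
  exists J : {set 'I_(d + s)},
    (s.+1 <= #|J|)%N /\ (forall j : 'I_(d + s), j \in J -> metrizable R (K j)).
Proof.
have fjcont j : continuous (fun u => f u j).
  move=> u; apply: (@continuous_comp _ _ _ f (fun y => y j)); first exact: fcont.
  exact: (@proj_continuous _ (fun j => K j) j).
pose J : {set 'I_(d + s)} := finset (fun j => `[< metrizable R (K j) >]).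
exists J; split; last by move=> j; rewrite inE => /asboolP.
rewrite ltnNge; apply/negP => Js.
have : (d <= #|~: J|)%N by have := cardsC J; rewrite card_ord; lia.
move=> /card_geqP[D0 [D0uniq D0size D0J]].
pose D : {set 'I_(d + s)} := finset (mem D0).
have Dcard : #|D| = d by rewrite cardsE; have /card_uniqP -> := D0uniq.
have Dnmet j : j \in D -> ~ metrizable R (K j).
  by rewrite inE => /D0J; rewrite !inE => /asboolP.
have [j0 j0D] : exists j0, j0 \notin D.
  have : (0 < #|~: D|)%N by have := cardsC D; rewrite card_ord; lia.
  by move=> /card_gt0P[j]; rewrite inE; exists j.
have slope j : exists k, j \in D ->
    forall n, cell_separated (fun u => f u j) n (k * n).
  have [/Dnmet nmet|_] := boolP (j \in D); last by exists 0%N.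
  have := nonmetrizable_cell_separated hL (hKcpt j) (hKT2 j) (fjcont j) nmet.
  by move=> [k]; exists k.
have [k kP] := choice slope.
pose kappa := (\sum_(j in D) k j)%N.
pose M := ((kappa.*2.+1) ^ d).+1.
have [c cP] := infinite_cell_separated (R := R) hL (hKcpt j0) (hKT2 j0)
  (fjcont j0) M (hKinf j0).
(* With this [n], twice the number of endpoints plus one is an exact multiple
   of [n]. *)
pose n := c.*2.+1.
(* The factors other than [j0] and those of [D] contribute a single point. *)
pose m j := if j == j0 then M else if j \in D then n else 1%N.
pose N j := if j == j0 then c else if j \in D then (k j * n)%N else 0%N.
have sep j : cell_separated (fun u => f u j) (m j) (N j).
  rewrite /m /N; have [->|_] := eqVneq j j0; first exact: cP.
  have [jD|_] := boolP (j \in D); first exact: kP.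
  by have [x _] := infinite_setN0 (hKinf j); exact: cell_separated1.
have := cell_separated_count fsurj sep.
have -> : (\prod_j m j = M * n ^ d)%N.
  rewrite (bigD1 j0) //= {1}/m eqxx; congr (_ * _)%N.
  transitivity (n ^ #|D|)%N; last by rewrite Dcard.
  rewrite -prod_nat_const [RHS]big_mkcond.
  rewrite (bigD1 j0 (F := fun j => if j \in D then n else 1%N)) //=.
  rewrite (negPf j0D) mul1n; apply: eq_bigr => j /negPf jj0.
  by rewrite /m jj0.
have -> : (\sum_j N j = c + kappa * n)%N.
  rewrite (bigD1 j0) //= {1}/N eqxx; congr (_ + _)%N.
  rewrite big_distrl /= [RHS]big_mkcond.
  rewrite (bigD1 j0 (F := fun j => if j \in D then (k j * n)%N else 0%N)) //=.
  rewrite (negPf j0D) add0n; apply: eq_bigr => j /negPf jj0.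
  by rewrite /N jj0.
have -> : ((c + kappa * n).*2.+1 = kappa.*2.+1 * n)%N by rewrite /n; lia.
by rewrite expnMn leq_pmul2r ?expn_gt0// ltnn.
Qed.
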